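(* Let $A$ be a finite nonempty set, $X$ a nonempty set, $F:A\to\mathcal P(X)$ a soft set with nonempty sections, $\tau_1,\tau_2$ soft topologies on $F$, and $H$ a soft subset of $F$ with nonempty sections. If for every $t\in A$ the subset $H(t)$ is pairwise compact in $(F(t),(\tau_1)_t,(\tau_2)_t)$, then $H$ is pairwise soft compact in $(F,\tau_1,\tau_2)$.
   Context: A soft set over $X$ with parameter set $A$ is a map $F:A\to\mathcal P(X)$ with sections $F(t)$; $\mathrm{SE}(F)=\prod_{t\in A}F(t)$. A soft subset of $F$ is a map $H:A\to\mathcal P(X)$ with $H(t)\subseteq F(t)$ for all $t$; soft unions and intersections are parameterwise. A soft topology $\tau$ on $F$ is a family of soft subsets of $F$ containing $F$ and the empty soft set (all sections empty), closed under arbitrary soft unions and finite soft intersections. Component topology: $\tau_t=\{H(t):H\in\tau\}$ on $F(t)$. The selector (box) topology $\tau^\ast$ on $\mathrm{SE}(F)$ has base $\{\prod_{t\in A}U_t:U_t\in\tau_t\ \forall t\}$. For topologies $\alpha,\beta$ on a set, $\alpha\vee\beta$ is the topology generated by $\alpha\cup\beta$. A subset of a bitopological space $(Y,\alpha,\beta)$ is pairwise compact if it is compact as a subspace of $(Y,\alpha\vee\beta)$. A soft subset $H$ of $F$ with nonempty sections is pairwise soft compact if $\mathrm{SE}(H)=\prod_t H(t)$ is compact as a subspace of $(\mathrm{SE}(F),(\tau_1)^\ast\vee(\tau_2)^\ast)$. *)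

(* Defs.v *)
From HB Require Import structures.
From mathcomp Require Import all_boot.
From mathcomp Require Import boolp classical_sets functions.
From mathcomp Require Import topology.

Local Open Scope classical_set_scope.

(* A copy of [Y] carrying the topology generated by the family [G]: its open
   sets are the unions of finite intersections of members of [G]. *)
Definition generated_space {Y : Type} (G : set (set Y)) : Type := Y.

HB.instance Definition _ {Y : Type} (G : set (set Y)) :=
  gen_eqMixin (generated_space G).
HB.instance Definition _ {Y : Type} (G : set (set Y)) :=
  gen_choiceMixin (generated_space G).
HB.instance Definition _ {Y : Type} (G : set (set Y)) :=
  @isSubBaseTopological.Build (generated_space G) (set Y) G id.

(* [generated_space (alpha `|` beta)] is [Y] with the topology
   alpha \vee beta. *)
Definition pairwise_compact {Y : Type} (alpha beta : set (set Y))
    (K : set Y) : Prop :=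
  compact (K : set (generated_space (alpha `|` beta))).

Definition soft_set (A X : Type) : Type := A -> set X.

Section SoftSets.
Context {A X : Type}.
Local Notation soft_set := (soft_set A X).

Definition nonempty_sections (F : soft_set) : Prop := forall t, F t !=set0.

Definition soft_subset (H F : soft_set) : Prop := forall t, H t `<=` F t.

Definition soft0 : soft_set := fun=> set0.

Definition soft_bigcup (S : set soft_set) : soft_set :=
  fun t => \bigcup_(H in S) H t.

Definition soft_setI (H K : soft_set) : soft_set := fun t => H t `&` K t.

(* Closure under finite soft intersections is stated for two members; the empty
   intersection is [F] itself. *)
Definition soft_topology (F : soft_set) (tau : set soft_set) : Prop :=
  [/\ forall H, tau H -> soft_subset H F,
      tau F,
      tau soft0,
      forall S : set soft_set, S `<=` tau -> tau (soft_bigcup S) &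
      forall H K, tau H -> tau K -> tau (soft_setI H K)].

(* A section [H t] of a soft subset [H] of [F], as a subset of [F t]. *)
Definition section_in (F H : soft_set) (t : A) : set (F t) :=
  [set x : F t | H t (val x)].

Definition component_topology (F : soft_set) (tau : set soft_set) (t : A) :
    set (set (F t)) :=
  [set section_in F H t | H in tau].

Definition SE (F : soft_set) : Type := forall t : A, F t.

(* [SE H], as a subset of [SE F]. *)
Definition SE_in (F H : soft_set) : set (SE F) :=
  [set f : SE F | forall t, H t (val (f t))].

Definition box (F : soft_set) (U : forall t, set (F t)) : set (SE F) :=
  [set f : SE F | forall t, U t (f t)].

Definition selector_base (F : soft_set) (tau : set soft_set) :
    set (set (SE F)) :=
  [set box F U | U in [set U : forall t, set (F t) |
                      forall t, component_topology F tau t (U t)]].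

Definition selector_topology (F : soft_set) (tau : set soft_set) :
    set (set (SE F)) :=
  [set \bigcup_(B in S) B | S in [set S | S `<=` selector_base F tau]].

Definition pairwise_soft_compact (F : soft_set) (tau1 tau2 : set soft_set)
    (H : soft_set) : Prop :=
  pairwise_compact (selector_topology F tau1) (selector_topology F tau2)
    (SE_in F H).

End SoftSets.

(* Main.v *)
(** It suffices to find a limit for every ultrafilter containing [SE H]. Its
   image under the projection to [t] contains [H t], hence has a cluster point
   [p t] in [H t], and since the image is again ultra it contains every
   subbasic neighborhood of [p t]. A box around [p] is a finite intersection of
   preimages of such neighborhoods, so the ultrafilter contains it; the open
   boxes around [p] generate the neighborhoods of [p]. *)
Require Import Defs.
From mathcomp Require Import all_boot.
From mathcomp Require Import boolp classical_sets.
From mathcomp Require Import topology.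

Local Open Scope classical_set_scope.

Lemma generated_open {Y : Type} (G : set (set Y)) (U : set Y) :
  G U -> open (U : set (generated_space G)).
Proof.
move=> GU; exists [set U]; last by rewrite bigcup_set1.
by move=> _ ->; exact: (@finI_from1 _ _ G id).
Qed.

(** Every neighborhood of [p] contains a finite intersection of members of [G] through [p], and
    filters are closed under finite intersections and supersets. *)
Lemma cvg_generated {Y : Type} (G : set (set Y)) (Phi : set_system Y)
    (p : Y) : Filter Phi -> (forall U, G U -> U p -> Phi U) ->
  Phi --> (p : generated_space G).
Proof.
move=> PhiF PhiG B; rewrite nbhsE => -[O [[S SfinI <-] [C SC Cp]] subB].
have [D DG defC] := SfinI _ SC.
apply: (filterS (P := C)).
  by move=> y Cy; apply: subB; exists C.
rewrite -defC; apply: filter_bigI => U UD.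
apply: PhiG; first by have := DG _ UD; rewrite inE.
by move: Cp; rewrite -defC; apply.
Qed.

(** Otherwise the ultrafilter contains the preimage of the complement of [U], and clustering at [q]
    would make this complement meet [U]. *)
Lemma ultra_image_cluster {Z : Type} {T : topologicalType}
    (Phi : set_system Z) (f : Z -> T) (q : T) (U : set T) :
  UltraFilter Phi -> cluster (f @ Phi) q -> nbhs q U -> Phi (f @^-1` U).
Proof.
move=> PhiU fq qU.
have [//|PhiUC] := in_ultra_setVsetC (f @^-1` U) PhiU.
by have [y []] := fq (~` U) U PhiUC qU.
Qed.

Lemma selector_topology_filter {A : finType} {X : Type} (F : soft_set A X)
    (tau : set (soft_set A X)) (Phi : set_system (SE F)) (p : SE F) :
  Filter Phi ->
  (forall t U, component_topology F tau t U -> U (p t) ->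
     Phi [set f | U (f t)]) ->
  forall O, selector_topology F tau O -> O p -> Phi O.
Proof.
move=> PhiF Phip _ [S Sbase <-] [B SB Bp].
have [U Utau defB] := Sbase _ SB.
apply: (filterS (P := B)); first by move=> f Bf; exists B.
move: Bp; rewrite -defB => Up.
(* Finiteness of [A] enters here: the box is a finite intersection of preimages of its sides. *)
by apply: (filter_forall (f := fun t f => U t (f t))) => t; exact: Phip.
Qed.

Theorem theorem6p3 (A : finType) (X : Type)
    (A_nonempty : [set: A] !=set0) (X_nonempty : [set: X] !=set0)
    (F : soft_set A X) (F_nonempty : nonempty_sections F)
    (tau1 tau2 : set (soft_set A X))
    (tau1_top : soft_topology F tau1) (tau2_top : soft_topology F tau2)
    (H : soft_set A X) (H_sub : soft_subset H F)
    (H_nonempty : nonempty_sections H) :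
  (forall t : A, pairwise_compact
     (component_topology F tau1 t) (component_topology F tau2 t)
     (section_in F H t)) ->
  pairwise_soft_compact F tau1 tau2 H.
Proof.
move=> Hcompact; rewrite /pairwise_soft_compact /pairwise_compact.
rewrite compact_ultra => Phi PhiU PhiH.
(* With both component topologies in one subbase, a single cluster point per parameter serves [tau1]
   and [tau2] at once. *)
pose G t := component_topology F tau1 t `|` component_topology F tau2 t.
pose pr t (f : SE F) : generated_space (G t) := f t.
have limit t : exists q : F t,
    section_in F H t q /\ cluster (pr t @ Phi) (q : generated_space (G t)).
  have PhiHt : Phi [set f | section_in F H t (f t)].
    by apply: filterS PhiH => f Hf; exact: Hf.
  have [q [Hq clq]] := Hcompact t (pr t @ Phi) _ PhiHt.
  by exists q.
have {limit} [p plim] : exists p : SE F, forall t, section_in F H t (p t) /\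
    cluster (pr t @ Phi) (p t : generated_space (G t)).
  (* Choice assembles the coordinatewise cluster points into a selector. *)
  by exists (fun t => sval (cid (limit t))) => t; exact: svalP (cid (limit t)).
exists p; split; first by move=> t; exact: (plim t).1.
have Phip t U : G t U -> U (p t) -> Phi [set f | U (f t)].
  move=> GU Up; apply: (ultra_image_cluster Phi (pr t) (p t) U) => //.
    exact: (plim t).2.
  by apply: open_nbhs_nbhs; split=> //; exact: generated_open.
(* The two cases are the two selector topologies generating the join; in each, the sides of a box
   belong to [G t]. *)
apply: cvg_generated => O [] /selector_topology_filter; apply=> t U tauU.
  by apply: Phip; left.
by apply: Phip; right.
Qed.
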